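(* Let $\alpha$ be a nonnegative integer with $\alpha\neq 2$ and let $m=2^{\alpha}$. Let $A, B\subseteq \mathbb{Z}_{m}$ with $A\cup B=\mathbb{Z}_{m}$ and $|A\cap B|=2$. Then $R_{A}(\overline{n})=R_{B}(\overline{n})$ for all $\overline{n}\in \mathbb{Z}_{m}$ if and only if $B=A+\overline{\frac{m}{2}}$.
   Context: For a positive integer $m$, $\mathbb{Z}_{m}$ is the set of residue classes modulo $m$. For $\overline{a},\overline{b}\in\mathbb{Z}_m$, write $\overline{a}\leq\overline{b}$ if $a'\le b'$, where $a',b'\in\{0,1,\dots,m-1\}$ are the representatives with $\overline{a'}=\overline{a}$, $\overline{b'}=\overline{b}$. For $A\subseteq\mathbb{Z}_m$ and $\overline{n}\in\mathbb{Z}_m$, $R_A(\overline{n})$ denotes the number of solutions of $\overline{n}=\overline{a}+\overline{a'}$ with $\overline{a}\leq\overline{a'}$ and $\overline{a},\overline{a'}\in A$ (i.e. unordered pairs, with $\overline{a}=\overline{a'}$ allowed). For $\overline{n}\in\mathbb{Z}_m$ and $A\subseteq\mathbb{Z}_m$, $\overline{n}+A=\{\overline{n}+\overline{a}:\overline{a}\in A\}$, and $A+\overline{n}$ means the same set. *)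

(* Defs.v *)
From mathcomp Require Import all_boot all_algebra.

Set Implicit Arguments.
Unset Strict Implicit.
Unset Printing Implicit Defensive.

Import GRing.Theory.
Local Open Scope ring_scope.

(* The integers modulo m, for m > 0, as the library's additive group on
   {0, ..., m - 1}; 'Z_m is unsuitable because it is the integers modulo 2 when
   m = 1.  [inZp k] is the class of the natural number k. *)
Notation residues m := 'I_(m.-1.+1) (only parsing).

(* The order on residues is the order on representatives, through the coercion
   of ordinals to nat; the sum is taken modulo m. *)
Definition rep_count (m : nat) (A : {set residues m}) (n : residues m) : nat :=
  #|[set p : residues m * residues m |
      [&& p.1 \in A, p.2 \in A, (p.1 <= p.2)%N & n == p.1 + p.2]]|.

Definition translate (m : nat) (A : {set residues m}) (n : residues m) :
    {set residues m} :=
  [set n + a | a in A].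

(* Main.v *)
(* Put d = 1_A - 1_B and A :&: B = [set c1; c2].  Doubling the representation counts
   makes them ordered, and since 1_A + 1_B = 1 + 1_{c1, c2}, equality of the
   counts becomes the linear equation
     S + d(n - c1) + d(n - c2) + \sum_(2x = n) d(x) = 0,   S = \sum_x d(x);
   summing over n gives S = 0.  With F(x) = d(c1 + x), c = c2 - c1 and h = m/2:
     F(n + c) + F(n) = 0                         if n + c is odd,
     F(n + c) + F(n) + F(y) + F(y + h) = 0       if n + c = 2y,
   where F is zero exactly at 0 and c, and +-1 elsewhere.  If c = h (and m > 2), the
   function e(n) = F(n) + F(n + h) vanishes at odd n and satisfies
   e(2y) = - e(y), so e = 0, which says B = A + h.  The other values of c are
   impossible: for even c the antiperiodicity of F at odd arguments contradicts
   the second relation, and for odd c, if 8 divides m, the values of F at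
   multiples of c are forced until one of them leaves {-1, 0, 1}. *)
Require Import Defs.
From mathcomp Require Import all_boot all_algebra.
From mathcomp Require Import zify ring.

Set Implicit Arguments.
Unset Strict Implicit.
Unset Printing Implicit Defensive.
Import GRing.Theory.
Local Open Scope ring_scope.

(** * The functional equation for [F], by the parity of the shift [c] *)

(** Stated over [nat], where parity and halving make sense; modulo [2h] the halves of [n + c] are
    [y] and [y + h]. *)
Definition antidiff_eq (F : nat -> int) (h c : nat) : Prop :=
  (forall n, odd (n + c) -> F (n + c)%N + F n = 0) /\
  (forall n y, (n + c = y.*2)%N -> F (n + c)%N + F n + (F y + F (y + h)%N) = 0).

Lemma periodic_mul (F : nat -> int) (m : nat) :
  (forall n, F (n + m)%N = F n) -> forall k n, F (n + k * m)%N = F n.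
Proof.
move=> Fm; elim=> [|k IHk] n; first by rewrite mul0n addn0.
by rewrite mulSn addnA IHk Fm.
Qed.

(** For even [h], descent through [e y.*2 = - e y] ends at an odd argument, where [e] vanishes, or
    at 0, where [e 0 = - e 0]. For [h = 1] the first relation covers even [n], and the period [h] of
    [e] the rest. *)
Lemma antidiff_eq_half (F : nat -> int) (h : nat) :
  (forall n, F (n + h.*2)%N = F n) -> antidiff_eq F h h ->
  (h = 1%N \/ ~~ odd h) -> forall n, F (n + h)%N = - F n.
Proof.
move=> Fper [Fodd Feven] hh n; apply/eqP; rewrite -addr_eq0; apply/eqP.
pose e n := F (n + h)%N + F n; rewrite -/(e n).
have Fhh k : F (k + h + h)%N = F k by rewrite -addnA addnn.
have eh k : e (k + h)%N = e k by rewrite /e Fhh addrC.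
case: hh => [h1|hN].
  have eo k : odd (k + h) -> e k = 0 by apply: Fodd.
  case: (boolP (odd n)) => no; last by apply: eo; rewrite h1 oddD (negPf no).
  by rewrite -eh; apply: eo; rewrite h1 !oddD no.
have e2 y : e y.*2 = - e y.
  have := Feven (y.*2 + h)%N (y + h)%N ltac:(lia).
  by rewrite !Fhh /e; lia.
have [k] := ubnP n; elim: k n => // k IHk n nk.
case: (boolP (odd n)) => no.
  by apply: Fodd; rewrite oddD no (negPf hN).
have n2 : n = n./2.*2 by rewrite -{1}(odd_double_half n) (negPf no).
case: (posnP n) => [n0|n0]; last first.
  rewrite n2 e2 IHk ?oppr0 //; lia.
by have := e2 0%N; rewrite n0 double0; lia.
Qed.

Lemma antidiff_eq_even_shift (F : nat -> int) (h c : nat) :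
  (forall n, F (n + h.*2)%N = F n) -> antidiff_eq F h c ->
  (forall n, -1 <= F n <= 1) -> F 0%N = 0 ->
  (forall n, odd n -> F n != 0) ->
  ~~ odd c -> ~ (exists j i, j * c.*2 = h + i * h.*2)%N.
Proof.
move=> Fper [Fodd Feven] Fb F0 Fnz cN [j [i ji]].
have Fneg n : odd n -> F (n + c)%N = - F n.
  by move=> no; apply/eqP; rewrite -addr_eq0 Fodd // oddD no.
have F2 k n : odd n -> F (n + k * c.*2)%N = F n.
  move=> no; elim: k => [|k IHk]; first by rewrite addn0.
  have -> : (n + k.+1 * c.*2 = n + k * c.*2 + c + c)%N by lia.
  by rewrite !Fneg ?opprK // !oddD !oddM odd_double no ?(negPf cN) andbF.
(* h is an even multiple of c, so the sign changes cancel. *)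
have Fh n : odd n -> F (n + h)%N = F n.
  by move=> no; rewrite -(F2 j n no) ji addnA (periodic_mul Fper).
have c2 : c = c./2.*2 by rewrite -{1}(odd_double_half c) (negPf cN).
set b := c./2 in c2.
(* The two halves contribute [2 F(y)] with [F(y)] equal to 1 or -1, so the bound on [F] forces both
   other terms. *)
have Fdbl n y : odd y -> (n + c = y.*2)%N -> F (n + c)%N = - F y /\ F n = - F y.
  move=> yo /Feven; rewrite (Fh _ yo).
  have := Fnz _ yo; have := Fb y; have := Fb n; have := Fb (n + c)%N; lia.
case: (boolP (odd b)) => bo.
  by have [] := Fdbl 0%N b bo c2; rewrite F0; have := Fnz _ bo; lia.
have o1 : odd (1 + b) by rewrite oddD (negPf bo).
have o2 : odd (1 + c) by rewrite oddD (negPf cN).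
have o3 : odd (1 + b + c) by rewrite oddD o1 (negPf cN).
(* These give F(1 + b) = F(1 + c) = F(1 + b + c), against the sign change under [c] at the odd
   argument [1 + b]. *)
have [E1 _] := Fdbl 2%N (1 + b)%N o1 ltac:(lia).
have [E2 E2'] := Fdbl (2 + c)%N (1 + c)%N o2 ltac:(lia).
have [_ E3] := Fdbl (2 + c + c)%N (1 + b + c)%N o3 ltac:(lia).
have := Fneg _ o1; have := Fnz _ o1; lia.
Qed.

Lemma antidiff_eq_odd_shift (F : nat -> int) (h c : nat) :
  (forall n, F (n + h.*2)%N = F n) -> antidiff_eq F h c ->
  (forall n, -1 <= F n <= 1) -> F 0%N = 0 -> F c.*2 != 0 ->
  odd c -> ~ (exists u, h = u * 4 /\ (u = 1 \/ ~~ odd u))%N.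
Proof.
move=> Fper [Fodd Feven] Fb F0 Fc2 co [u [hu uu]].
(* p is F at even multiples of c; the relations force p to be constant at odd
   arguments and to be the opposite constant at arguments 2 mod 4. *)
pose p k := F (k.*2 * c)%N.
have pb k : -1 <= p k <= 1 by apply: Fb.
have Fodd1 k : F (k.*2.+1 * c)%N = - p k.
  apply/eqP; rewrite -addr_eq0 /p -(Fodd (k.*2 * c)%N) ?oddD ?oddM ?odd_double //.
  by rewrite mulSn [(c + _)%N]addnC.
(* As [c] is odd, [h * c] is congruent to [h] modulo [2h], so adding [h = 4u] amounts to adding [4u]
   multiples of [c]. *)
have Fh k : F (k * c + h)%N = F ((k + u * 4) * c)%N.
  rewrite -hu mulnDl.
  have -> : (k * c + h * c = k * c + h + c./2 * h.*2)%N.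
    have := odd_double_half c; rewrite co => c2; nia.
  by rewrite (periodic_mul Fper).
have step k : p k.+1 = p k - F (k.+1 * c)%N - F ((k.+1 + u * 4) * c)%N.
  have := Feven (k.*2.+1 * c)%N (k.+1 * c)%N; rewrite Fodd1 Fh.
  have -> : (k.*2.+1 * c + c = k.+1.*2 * c)%N by lia.
  rewrite -doubleMl => /(_ erefl); rewrite /p -!doubleMl; lia.
pose q l := p l + p (l + u.*2)%N.
have pS l : p l.*2.+1 = p l.*2 + q l.
  rewrite step Fodd1.
  have -> : (l.*2.+1 + u * 4 = (l + u.*2).*2.+1)%N by lia.
  by rewrite Fodd1 /q; lia.
have pSS l : p l.*2.+2 = p l.*2.+1 - q l.+1.
  rewrite step.
  have -> : (l.*2.+2 + u * 4 = (l.+1 + u.*2).*2)%N by lia.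
  by rewrite -doubleS /q /p; lia.
have podd l : p l.*2.+1 = p 1%N.
  by elim: l => // l IHl; rewrite pS doubleS pSS -IHl; lia.
have qodd l : q l.*2.+1 = 2 * p 1%N.
  rewrite /q podd.
  have -> : (l.*2.+1 + u.*2 = (l + u).*2.+1)%N by lia.
  by rewrite podd; lia.
have p2 l : p l.*2.+1.*2 = - p 1%N.
  by have := pS l.*2.+1; rewrite podd qodd; lia.
have p0 : p 0%N = 0 by rewrite /p mul0n.
have p1 : p 1%N != 0 by rewrite /p mul2n.
have p2' : p 2%N = - p 1%N by exact: (p2 0%N).
case: uu => [u1|uN].
  (* Here [q 0 = p 0 + p 2 = - p 1], while [pS] at 0 gives [p 1 = q 0]. *)
  have := pS 0%N; rewrite /q u1 double0 p0 add0n p2'; lia.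
(* For even [u], [2 + 2u] is 2 modulo 4. The value of [q 2] then forces [p 4 = p 1 - q 2 = 3 p 1],
   out of range. *)
have q2 : q 2%N = - 2 * p 1%N.
  rewrite /q; have -> : (2 + u.*2 = u./2.*2.+1.*2)%N.
    by rewrite -{1}(odd_double_half u) (negPf uN); lia.
  by rewrite p2' p2; lia.
have := pb 4%N; have : p 5%N = p 4%N + q 2%N := pS 2%N.
have -> : p 5%N = p 1%N := podd 2%N.
by rewrite q2; lia.
Qed.

(** * Representation counts as convolutions *)

Definition indic (T : finType) (A : {set T}) (x : T) : int := (x \in A)%:R.

(** Pairs with [x <= y] and their swaps together cover each ordered pair once, and the diagonal
    twice. *)
Lemma rep_count_double (m : nat) (A : {set residues m}) (n : residues m) :
  (rep_count A n)%:R *+ 2 =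
    \sum_x indic A x * indic A (n - x) + \sum_(x | x + x == n) indic A x.
Proof.
pose w x y : int := indic A x * indic A y * (n == x + y)%:R.
have wC x y : w x y = w y x by rewrite /w addrC [_ * indic A x]mulrC.
have repE : (rep_count A n)%:R = \sum_x \sum_y w x y * (x <= y)%N%:R.
  rewrite /rep_count cardsE -sum1_card natr_sum big_mkcond [RHS]pair_bigA /=.
  apply: eq_bigr => -[x y] _ /=; rewrite /w /indic.
  rewrite unfold_in /=.
  by case: (x \in A); case: (y \in A); case: (x <= y)%N; case: eqP.
have -> : (rep_count A n)%:R *+ 2 =
    \sum_x \sum_y (w x y + w x y * (x == y)%:R).
  rewrite mulr2n {1}repE exchange_big repE /= -big_split /=.
  apply: eq_bigr => x _; rewrite -big_split /=; apply: eq_bigr => y _.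
  rewrite [w y x]wC -mulrDr -[X in _ = X + _]mulr1 -mulrDr; congr (_ * _).
  by rewrite -val_eqE /=; case: ltngtP.
under eq_bigr do rewrite big_split /=; rewrite big_split /=; congr (_ + _).
  apply: eq_bigr => x _; rewrite (bigD1 (n - x)) //= big1 ?addr0; last first.
    move=> y ny; rewrite /w; case: eqP => [nE|_]; last by rewrite mulr0.
    by case/eqP: ny; rewrite nE addrC addKr.
  by rewrite /w [x + _]addrC subrK eqxx mulr1.
rewrite [RHS]big_mkcond /=; apply: eq_bigr => x _.
rewrite (bigD1 x) //= big1 ?addr0; last first.
  by move=> y /negPf yx; rewrite [x == y]eq_sym yx mulr0.
by rewrite /w eqxx mulr1 [n == _]eq_sym /indic; case: (x \in A); case: eqP.
Qed.

Section CoveringPair.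

Variables (G : finZmodType) (A B : {set G}) (c1 c2 : G).
Hypothesis cover : A :|: B = [set: G].
Hypothesis inter : A :&: B = [set c1; c2].
Hypothesis c12 : c1 != c2.

Let d x : int := indic A x - indic B x.

Lemma indic_add_cover x : indic A x + indic B x = 1 + (x == c1)%:R + (x == c2)%:R.
Proof.
have := in_setT x; have := in_set2 x c1 c2; rewrite -cover -inter !inE /indic.
case: (x =P c1) => [->|_]; first by rewrite (negPf c12); do 2!case: (_ \in _).
by case: (x == c2); do 2!case: (_ \in _).
Qed.

(** A difference of squares for convolution: the cross terms cancel under [x -> n - x], leaving [d]
    convolved with 1_A + 1_B. *)
Lemma sum_indic_sub n :
  \sum_x indic A x * indic A (n - x) - \sum_x indic B x * indic B (n - x) =
    \sum_x d x + d (n - c1) + d (n - c2).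
Proof.
have subI : injective (fun x : G => n - x) by exact: subrI.
have swap : \sum_x indic B x * indic A (n - x) = \sum_x indic A x * indic B (n - x).
  rewrite (reindex_inj subI) /=; apply: eq_bigr => x _.
  by rewrite subKr mulrC.
have pick c : \sum_x d x * (n - x == c)%:R = d (n - c).
  rewrite (bigD1 (n - c)) //= subKr eqxx mulr1 big1 ?addr0 // => x xc.
  by case: eqP => [cE|]; [case/eqP: xc; rewrite -cE subKr | rewrite mulr0].
transitivity (\sum_x d x * (indic A (n - x) + indic B (n - x))).
  transitivity (\sum_x (indic A x * indic A (n - x) - indic B x * indic B (n - x)
      + indic A x * indic B (n - x) - indic B x * indic A (n - x))).
    by rewrite sumrB big_split /= sumrB swap addrK.
  by apply: eq_bigr => x _; rewrite /d; ring.
under eq_bigr do rewrite indic_add_cover !mulrDr mulr1.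
by rewrite !big_split /= !pick.
Qed.

Lemma indic_sub_eq0 x : (d x == 0) = (x == c1) || (x == c2).
Proof.
have := in_setT x; rewrite -in_set2 -cover -inter !inE /d /indic.
by do 2!case: (_ \in _).
Qed.

Lemma antisymmetric_translate (h : G) : h + h = 0 ->
  (forall x, d (x + h) = - d x) -> B = [set h + a | a in A].
Proof.
move=> hh dh; apply/setP => x.
have -> : (x \in [set h + a | a in A]) = (x + h \in A).
  apply/imsetP/idP => [[a aA ->]|xA]; first by rewrite addrAC hh add0r.
  by exists (x + h); rewrite // [x + h]addrC addrA hh add0r.
have := dh x; have := in_setT x; have := in_setT (x + h).
rewrite -cover !inE /d /indic.
by do 4!case: (_ \in _).
Qed.

End CoveringPair.

(** Moving both summands by [h] moves their sum by [h + h = 0]. Translation need not respect the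
    order on representatives, hence the passage through doubled counts. *)
Lemma rep_count_translate (m : nat) (A : {set residues m}) (h n : residues m) :
  h + h = 0 -> rep_count (translate A h) n = rep_count A n.
Proof.
move=> hh; have addI : injective (fun x : residues m => x + h) by exact: addIr.
have memT x : indic (translate A h) (x + h) = indic A x.
  by rewrite /indic /translate addrC (mem_imset _ _ (addrI h)).
have memT' x : indic (translate A h) (x - h) = indic A x.
  by rewrite -memT; congr (indic _ _); rewrite -{2}(subrK h x) -addrA hh addr0.
suff : (rep_count (translate A h) n)%:R *+ 2 = (rep_count A n)%:R *+ 2 :> int.
  by lia.
rewrite !rep_count_double (reindex_inj addI) [X in _ + X](reindex_inj addI) /=.
congr (_ + _); first by apply: eq_bigr => x _; rewrite opprD addrA memT memT'.
by apply: eq_big => [x|x _]; rewrite ?memT // addrACA hh addr0.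
Qed.

(** Summed over [n], each shift gives S, and so does the last term since each [x] is a half of
    exactly one [n]; hence (|G| + 3) S = 0. *)
Lemma sum_eq0_of_shifts (G : finZmodType) (d : G -> int) (c1 c2 : G) :
  (forall n, \sum_x d x + d (n - c1) + d (n - c2) + \sum_(x | x + x == n) d x = 0) ->
  \sum_x d x = 0.
Proof.
move=> E; set S := \sum_x d x in E *.
have shift c : \sum_n d (n - c) = S.
  by rewrite /S [RHS](reindex_inj (addIr (- c))).
have halves : \sum_n \sum_(x | x + x == n) d x = S.
  by rewrite /S [RHS](partition_big (fun x => x + x) predT).
have : \sum_n (S + d (n - c1) + d (n - c2) + \sum_(x | x + x == n) d x) = 0.
  by rewrite big1.
rewrite !big_split /= !shift halves sumr_const => SE.
have : S * (#|{: G}| + 3)%:R = 0.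
  by rewrite -[RHS]SE -mulr_natr natrD; ring.
by move/eqP; rewrite mulf_eq0 Num.Theory.pnatr_eq0 addn3 orbF => /eqP.
Qed.

(** * Halving residues modulo [2h] *)

Lemma inZpD (p a b : nat) : inZp (a + b) = inZp a + inZp b :> 'I_p.+1.
Proof. by apply: val_inj; rewrite /= modnDm. Qed.

Section Doubling.

Variables (m h : nat).
Hypothesis h_gt0 : (0 < h)%N.
Hypothesis mE : m = h.*2.

Let modE : m.-1.+1 = h.*2.
Proof. by rewrite mE prednK // double_gt0. Qed.

Lemma inZp_half_double : inZp h + inZp h = 0 :> residues m.
Proof. by rewrite -inZpD; apply: val_inj; rewrite /= modE addnn modnn. Qed.

Lemma half_neq0 : inZp h != 0 :> residues m.
Proof.
by rewrite -val_eqE /= modE modn_small; [rewrite -lt0n | rewrite -addnn -addn1 leq_add2l].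
Qed.

Lemma inZp_period k : inZp (k + h.*2) = inZp k :> residues m.
Proof. by apply: val_inj; rewrite /= modE modnDr. Qed.

Lemma inZp_odd_neq_double k (x : residues m) : odd k -> x + x != inZp k.
Proof.
move=> ko; have mo : odd m.-1.+1 = false by rewrite modE odd_double.
apply/eqP => /(congr1 (fun z : residues m => odd z)) /=.
by rewrite !odd_mod // addnn odd_double ko.
Qed.

Lemma double_eq0 (x : residues m) : (x + x == 0) = (x == 0) || (x == inZp h).
Proof.
apply/idP/idP; last by case/orP => /eqP ->; rewrite ?addr0 ?inZp_half_double.
move: (ltn_ord x); rewrite -!val_eqE /=; move: (nat_of_ord x) => y.
rewrite modE => ym; have hm : (h < h.*2)%N by rewrite -addnn -addn1 leq_add2l.
rewrite addnn -!muln2 -muln_modl muln_eq0 orbF muln2 (modn_small hm).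
rewrite -/(dvdn h y) => /dvdnP[q yE].
move: ym; rewrite yE -mul2n ltn_pmul2r //.
by case: q yE => [|[|]] // _ _; rewrite ?mul0n ?mul1n eqxx ?orbT.
Qed.

Lemma sum_halves (d : residues m -> int) (c : residues m) k :
  \sum_(x | x + x == c + c + inZp k.*2) d x =
    d (c + inZp k) + d (c + inZp (k + h)).
Proof.
rewrite (reindex_inj (addrI (c + inZp k))) /=.
have -> : \sum_(x | c + inZp k + x + (c + inZp k + x) == c + c + inZp k.*2)
    d (c + inZp k + x) =
    \sum_(x | (x == 0) || (x == inZp h)) d (c + inZp k + x).
  apply: eq_bigl => x; rewrite -double_eq0 addrACA [X in X + _]addrACA.
  by rewrite -inZpD addnn -[X in _ == X]addr0 (inj_eq (addrI _)).
rewrite (bigD1 0) //= addr0; congr (_ + _).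
rewrite (big_pred1 (inZp h)) ?inZpD ?addrA // => x.
by case: eqP => [->|_] /=; rewrite ?andbF ?andbT // eq_sym (negPf half_neq0).
Qed.

Lemma sum_halves_odd (d : residues m -> int) (c : residues m) k : odd k ->
  \sum_(x | x + x == c + c + inZp k) d x = 0.
Proof.
move=> ko; apply: big_pred0 => x; apply/negbTE.
have := inZp_odd_neq_double (x - c) ko; apply: contra => /eqP xE.
by rewrite addrACA xE -opprD addrAC subrr add0r.
Qed.

(* Without %R the shift would be the truncated difference of representatives. *)
Lemma antidiff_eq_residues (d : residues m -> int) (c1 c2 : residues m) :
  (forall n, d (n - c1) + d (n - c2) + \sum_(x | x + x == n) d x = 0) ->
  antidiff_eq (fun k => d (c1 + inZp k)) h (c2 - c1)%R.
Proof.
move=> E; set c : nat := nat_of_ord (c2 - c1).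
(* Evaluating [E] at [2 c1 + n + c] puts every argument of [d] in the form [c1 + _]. *)
have E1 n : d (c1 + inZp (n + c)) + d (c1 + inZp n)
    + \sum_(x | x + x == c1 + c1 + inZp (n + c)) d x = 0.
  rewrite -[RHS](E (c1 + c1 + inZp (n + c))); congr (d _ + d _ + _).
    by rewrite -[c1 + c1 + _]addrA [RHS]addrC addKr.
  by rewrite inZpD valZpK [inZp n + _]addrA addrACA subrr addr0 addrA addrK.
split=> [n no|n y ny]; first by have := E1 n; rewrite (sum_halves_odd _ _ no) addr0.
by have := E1 n; rewrite ny sum_halves.
Qed.

End Doubling.

(** * Locating the shift when [h] is a power of two *)

(** The gcd of [c] and 2^(k+1) is 2^s with s <= k; scale its Bezout identity by 2^(k-s). *)
Lemma half_multiple (k c : nat) : ~~ (2 ^ k.+1 %| c)%N ->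
  exists j i, (j * c = 2 ^ k + i * 2 ^ k.+1)%N.
Proof.
move=> Nc.
have c0 : (0 < c)%N by case: c Nc; rewrite ?dvdn0.
have [s sk gE] : exists2 s, (s <= k.+1)%N & gcdn c (2 ^ k.+1) = (2 ^ s)%N.
  by apply/dvdn_pfactor => //; exact: dvdn_gcdr.
have sk1 : (s <= k)%N.
  rewrite -ltnS ltn_neqAle sk andbT; apply: contra Nc => /eqP <-.
  by rewrite -gE dvdn_gcdl.
case: (egcdnP (2 ^ k.+1) c0) => u v uv _; rewrite gE in uv.
exists (u * 2 ^ (k - s))%N, (v * 2 ^ (k - s))%N.
by rewrite mulnAC uv mulnDl -expnD subnKC // addnC mulnAC.
Qed.

Lemma antidiff_eq_shift_half (F : nat -> int) (k c : nat) :
  k <> 1%N -> (forall n, F (n + (2 ^ k).*2)%N = F n) -> antidiff_eq F (2 ^ k) c ->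
  (forall n, -1 <= F n <= 1) -> (0 < c < (2 ^ k).*2)%N ->
  (forall n, (F n == 0) = (n %% (2 ^ k).*2 == 0)%N || (n %% (2 ^ k).*2 == c)%N) ->
  c = (2 ^ k)%N.
Proof.
move=> k1; set h := (2 ^ k)%N => Fper Feq Fb /andP[c0 ch] Fz.
have h0 : (0 < h)%N by rewrite expn_gt0.
have F0 : F 0%N = 0 by apply/eqP; rewrite Fz mod0n.
have cP : (h %| c)%N -> c = h.
  by case/dvdnP=> [[|[|q]]] cE; rewrite ?mul0n ?mul1n in cE *; lia.
case: (boolP (odd c)) => co.
  (* [k = 0] leaves only [c = 1 = h], and [k = 1] (modulus 4) is excluded; from here on 4 divides
     [h]. *)
  case: k k1 @h => [|[|k]] // _ h in Fper Feq Fz h0 ch cP *; first by lia.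
  have h4 : h = (2 ^ k * 4)%N by rewrite /h !expnS; lia.
  case: (antidiff_eq_odd_shift Fper Feq Fb F0 _ co).
    rewrite Fz -!muln2 -muln_modl muln_eq0 orbF -/(dvdn h c) negb_or.
    apply/andP; split; apply: contraL co; last by move/eqP <-; rewrite muln2 odd_double.
    by case/dvdnP=> q ->; rewrite h4 !oddM !andbF.
  exists (2 ^ k)%N; split=> //; rewrite oddX orbF.
  by case: (k) => [|k']; [left | right].
(* Either [2h] divides [2c], so [h] divides [c], or some multiple of [2c] is [h] modulo [2h], which
   rules out even [c]. *)
case: (boolP (2 ^ k.+1 %| c.*2)%N) => [|/half_multiple[j [i ji]]].
  by rewrite expnS -!mul2n dvdn_pmul2l // => /cP.
case: (antidiff_eq_even_shift Fper Feq Fb F0 _ co).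
  move=> n no; rewrite Fz; have := odd_mod n (odd_double h); rewrite no.
  by case: eqP => [->//|_]; case: eqP => [->|//]; rewrite (negPf co).
by exists j, i; rewrite ji expnS mul2n.
Qed.

Local Close Scope ring_scope.

Theorem theorem1 (alpha : nat) (halpha : alpha <> 2)
    (m : nat) (hm : m = 2 ^ alpha)
    (A B : {set residues m})
    (hcover : A :|: B = [set: residues m])
    (hinter : #|A :&: B| = 2) :
  (forall n : residues m, rep_count A n = rep_count B n)
    <-> B = translate A (inZp (m %/ 2)).
Proof.
(* For [alpha = 0] there is a single residue, too few for the intersection; otherwise m/2 = 2^k. *)
case: alpha => [|k] in halpha hm *.
  have := max_card (mem (A :&: B)); rewrite hinter card_ord => m2.
  by exfalso; move: m2; rewrite hm.
have k1 : k <> 1 by move=> kE; rewrite kE in halpha.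
have {hm} mE : m = (2 ^ k).*2 by rewrite hm expnS mul2n.
have h0 : 0 < 2 ^ k by rewrite expn_gt0.
have -> : m %/ 2 = 2 ^ k by rewrite mE -muln2 mulnK.
have hh := inZp_half_double h0 mE.
split=> [Erep|->] => [|n]; last by rewrite rep_count_translate.
have /cards2P[c1 [c2 [c12 inter]]] : #|A :&: B| == 2 by rewrite hinter.
pose d (x : residues m) : int := (indic A x - indic B x)%R.
have E n : (\sum_x d x + d (n - c1) + d (n - c2) + \sum_(x | x + x == n) d x = 0)%R.
  rewrite -(sum_indic_sub hcover inter c12) sumrB addrACA -opprD.
  have := rep_count_double A n; rewrite Erep (rep_count_double B n) => ->.
  by rewrite subrr.
have S0 := sum_eq0_of_shifts E.
have {S0}E n : (d (n - c1) + d (n - c2) + \sum_(x | x + x == n) d x = 0)%R.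
  by rewrite -[RHS](E n) S0 add0r.
have Feq := antidiff_eq_residues h0 mE E.
set F := (fun k => _) in Feq.
have Fper n : F (n + (2 ^ k).*2) = F n by rewrite /F (inZp_period h0 mE).
have Fb n : (-1 <= F n <= 1)%R.
  by rewrite /F /d /indic; case: (_ \in A); case: (_ \in B).
have m1 : m.-1.+1 = (2 ^ k).*2 by rewrite mE prednK // double_gt0.
have cE : nat_of_ord (c2 - c1)%R = 2 ^ k.
  apply: (antidiff_eq_shift_half k1 Fper Feq Fb).
    apply/andP; split; last first.
      by move: (ltn_ord (c2 - c1)%R); move: (nat_of_ord _) => y; rewrite m1.
    rewrite lt0n; apply: contraNneq c12 => c0.
    by rewrite eq_sym -subr_eq0; apply/eqP/val_inj.
  move=> n; rewrite /F (indic_sub_eq0 hcover inter).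
  have -> : (c1 + inZp n == c1)%R = (inZp n == 0 :> residues m)%R.
    by rewrite -{2}[c1]addr0 (inj_eq (addrI _)).
  have -> : (c1 + inZp n == c2)%R = (inZp n == c2 - c1)%R.
    by rewrite eq_sym addrC -subr_eq eq_sym.
  move: (c2 - c1)%R => y; rewrite -!val_eqE /=.
  by move: (nat_of_ord y) => z; rewrite m1.
rewrite cE in Feq.
have Fanti : forall n, F (n + 2 ^ k) = (- F n)%R.
  apply: (antidiff_eq_half Fper Feq); case: (k) => [|k']; [by left | right].
  by rewrite expnS oddM.
apply: (antisymmetric_translate hcover hh) => x.
have := Fanti (x - c1)%R.
by rewrite /F inZpD valZpK addrA [(c1 + _)%R]addrC subrK.
Qed.
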